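(* Let $\mathfrak X$ be a homogeneous tree of degree $q+1$ ($q\geq1$) and let $\{f_j\}_{j\in\mathbb Z}$ be a wave on $\mathfrak X$. Then for all integers $n$ and $k$, $$f_{nk}=U_{n-1}\big(T_k(\mu_1)\big)f_k-U_{n-2}\big(T_k(\mu_1)\big)f_0.$$
   Context: $\mathfrak X$ is a tree in which every vertex has exactly $q+1$ edges; $\mathcal F(\mathfrak X)$ is the space of complex-valued functions on its vertices; $\mu_1f(v)=\frac{1}{q+1}\sum_{w\text{ adjacent to }v}f(w)$. A wave is a family $\{f_j\}_{j\in\mathbb Z}$ in $\mathcal F(\mathfrak X)$ with $\mu_1f_j=\frac{f_{j+1}+f_{j-1}}{2}$ for all $j$. $T_m$: Chebyshev polynomials of the first kind, $T_0=1$, $T_1(x)=x$, $T_{m+1}=2xT_m-T_{m-1}$, $T_{-m}=T_m$. $U_n$: Chebyshev polynomials of the second kind, $U_0=1$, $U_1(x)=2x$, $U_k=2xU_{k-1}-U_{k-2}$, with $U_{-n-1}=-U_{n-1}$ for $n\geq0$ (so $U_{-1}=0$, $U_{-2}=-1$). Polynomials are applied to operators in the usual way. *)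

(* Defs.v *)
From mathcomp Require Import all_boot all_order all_algebra.
From mathcomp Require Import boolp classical_sets functions cardinality fsbigop.
From mathcomp Require Import reals.
From mathcomp Require Import complex.

Set Implicit Arguments.
Unset Strict Implicit.
Unset Printing Implicit Defensive.

Import GRing.Theory Num.Theory.

Local Open Scope classical_set_scope.
Local Open Scope card_scope.
Local Open Scope ring_scope.

(* A closed walk [:: x; y] only runs back and forth along one edge, hence the
   bound on the length of the excluded cycles. *)
Definition is_tree (V : choiceType) (e : rel V) : Prop :=
  [/\ inhabited V,
      irreflexive e,
      symmetric e,
      forall x y : V, exists2 p : seq V, path e x p & last x p = y
    & forall c : seq V, (2 < size c)%N -> ~ ucycle e c].

Definition homogeneous_tree (V : choiceType) (e : rel V) (q : nat) : Prop :=
  is_tree e /\ forall v : V, [set w | e v w] #= `I_q.+1.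

(* The sum over a set is 0 by convention when infinitely many terms are nonzero;
   in a homogeneous tree the set of neighbours is finite. *)
Definition mu1 (R : realType) (V : choiceType) (e : rel V) (q : nat)
    (f : V -> R[i]) : V -> R[i] :=
  fun v => (q.+1%:R)^-1 * \sum_(w \in [set w | e v w]) f w.

Definition is_wave (R : realType) (V : choiceType) (e : rel V) (q : nat)
    (f : int -> V -> R[i]) : Prop :=
  forall j : int, mu1 e q (f j) = 2^-1 *: (f (j + 1) + f (j - 1)).

Fixpoint chebT_nat (K : nzRingType) (n : nat) : {poly K} :=
  match n with
  | 0 => 1
  | 1 => 'X
  | (m.+1 as m').+1 => 2 *: ('X * chebT_nat K m') - chebT_nat K m
  end.

Definition chebT (K : nzRingType) (m : int) : {poly K} := chebT_nat K `|m|%N.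

Fixpoint chebU_nat (K : nzRingType) (n : nat) : {poly K} :=
  match n with
  | 0 => 1
  | 1 => 2 *: 'X
  | (m.+1 as m').+1 => 2 *: ('X * chebU_nat K m') - chebU_nat K m
  end.

(* [Negz n] denotes [- n.+1], so the last two cases read
   U_(-1) = 0 and U_(-(n+1)-1) = - U_n. *)
Definition chebU (K : nzRingType) (m : int) : {poly K} :=
  match m with
  | Posz n => chebU_nat K n
  | Negz 0 => 0
  | Negz n.+1 => - chebU_nat K n
  end.

(* The operator p(A), with A^i the i-fold composite; MathComp has no algebra
   of endomorphisms of an infinite-dimensional module to which [horner_alg]
   could be applied. *)
Definition poly_op (K : nzRingType) (E : lmodType K) (p : {poly K})
    (A : E -> E) : E -> E :=
  fun x => \sum_(i < size p) p`_i *: iter i A x.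

(* Main.v *)
Require Import Defs.
From HB Require Import structures.
From mathcomp Require Import all_boot all_order all_algebra.
From mathcomp Require Import boolp classical_sets functions cardinality fsbigop.
From mathcomp Require Import reals.
From mathcomp Require Import complex.
From mathcomp Require Import zify.

Import GRing.Theory Num.Theory.

Local Open Scope ring_scope.

(** In any module, a family satisfying [2 A g_j = g_(j+1) + g_(j-1)] is
    determined by [g_0] and [g_1], and [U_(n-1)(A) g_1 - U_(n-2)(A) g_0] is the
    family with those initial values.  Since [2 T_k(mu1) f_j = f_(j+k) + f_(j-k)]
    by induction on [k], the subsequence [n |-> f_(n k)] is such a family for
    the operator [A = T_k(mu1)]. *)

Section PolyOp.
Context {K : comNzRingType} {E : lmodType K}.

(** Coefficients past the size vanish, so polynomials of different sizes can be evaluated over one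
    common index range. *)
Lemma poly_op_widen (A : E -> E) (p : {poly K}) (n : nat) (x : E) :
  (size p <= n)%N -> poly_op p A x = \sum_(i < n) p`_i *: iter i A x.
Proof.
move=> le_pn; rewrite /poly_op (big_ord_widen n (fun i => p`_i *: iter i A x)) //.
rewrite big_mkcond; apply: eq_bigr => i _.
by case: ltnP => // /(nth_default 0) ->; rewrite scale0r.
Qed.

Lemma poly_opD (A : E -> E) (p r : {poly K}) (x : E) :
  poly_op (p + r) A x = poly_op p A x + poly_op r A x.
Proof.
pose n := maxn (size p) (size r).
rewrite !(@poly_op_widen A _ n) ?leq_maxl ?leq_maxr ?size_polyD //.
by rewrite -big_split; apply: eq_bigr => i _; rewrite coefD scalerDl.
Qed.

Lemma poly_opZ (A : E -> E) (c : K) (p : {poly K}) (x : E) :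
  poly_op (c *: p) A x = c *: poly_op p A x.
Proof.
rewrite (poly_op_widen _ _ _ _ (size_scale_leq c p)) scaler_sumr.
by apply: eq_bigr => i _; rewrite coefZ scalerA.
Qed.

Lemma poly_opN (A : E -> E) (p : {poly K}) (x : E) :
  poly_op (- p) A x = - poly_op p A x.
Proof. by rewrite -[- p]scaleN1r poly_opZ scaleN1r. Qed.

Lemma poly_op0 (A : E -> E) (x : E) : poly_op (0 : {poly K}) A x = 0.
Proof. by rewrite /poly_op size_poly0 big_ord0. Qed.

Lemma poly_op1 (A : E -> E) (x : E) : poly_op (1 : {poly K}) A x = x.
Proof. by rewrite /poly_op size_poly1 big_ord1 coef1 scale1r. Qed.

Lemma poly_opXM (A : {linear E -> E}) (p : {poly K}) (x : E) :
  poly_op ('X * p) A x = A (poly_op p A x).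
Proof.
rewrite (@poly_op_widen _ _ (size p).+1); last first.
  by rewrite mulrC; apply: leq_trans (size_polyMleq _ _) _; rewrite size_polyX addn2.
rewrite big_ord_recl coefXM scale0r add0r linear_sum.
by apply: eq_bigr => i _; rewrite coefXM /= linearZ.
Qed.

Lemma poly_opX (A : {linear E -> E}) (x : E) :
  poly_op ('X : {poly K}) A x = A x.
Proof. by rewrite -[X in poly_op X]mulr1 poly_opXM poly_op1. Qed.

Section Linear.
Variables (A : {linear E -> E}) (p : {poly K}).

Lemma iter_linear (i : nat) : linear (iter i A).
Proof. by elim: i => // i IH a x y; rewrite !iterS IH linearP. Qed.

(** This lets the operator $T_k(\mu_1)$ in turn play the role of [A]. *)
Lemma poly_op_linear : linear (poly_op p A).
Proof.
move=> a x y; rewrite /poly_op scaler_sumr -big_split.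
by apply: eq_bigr => i _; rewrite iter_linear scalerDr !scalerA mulrC.
Qed.

HB.instance Definition _ :=
  GRing.isLinear.Build K E E *:%R (poly_op p A) poly_op_linear.
End Linear.

End PolyOp.

(** The convention for negative indices makes the recurrence two-sided: it passes through $U_{-1}=0$
    and $U_{-2}=-1$, and further left it is the recurrence on naturals with its sign changed. *)
Lemma chebUD2 (K : nzRingType) (m : int) :
  chebU K (m + 2) = 2 *: ('X * chebU K (m + 1)) - chebU K m.
Proof.
case: m => [n|[|[|n]]].
- by have [-> ->] : n%:Z + 2 = n.+2 /\ n%:Z + 1 = n.+1 by lia.
- by rewrite /= mulr1 subr0.
- by rewrite /= mulr0 scaler0 opprK add0r.
have [-> ->] : Negz n.+2 + 2 = Negz n /\ Negz n.+2 + 1 = Negz n.+1 by lia.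
case: n => [|n] /=; first by rewrite mulrN mulr1 scalerN opprK addNr.
by rewrite mulrN scalerN opprK addKr.
Qed.

Section TwoSidedRecurrence.
Context {K : comNzRingType} {E : lmodType K}.
Variable A : {linear E -> E}.

(** The denominator is cleared because 2 may fail to be invertible in [K]. *)
Definition chebyshev_recurrent (g : int -> E) : Prop :=
  forall j : int, 2 *: A (g j) = g (j + 1) + g (j - 1).

(** The recurrence can be solved for either outer term, so agreement on a consecutive pair
    propagates both upwards and downwards. *)
Lemma chebyshev_recurrent_eq (g h : int -> E) :
  chebyshev_recurrent g -> chebyshev_recurrent h ->
  g 0 = h 0 -> g 1 = h 1 -> g =1 h.
Proof.
move=> recg rech eq0 eq1 n; suff [] : g n = h n /\ g (n + 1) = h (n + 1) by [].
elim/int_rect: n => [//|n [eqn eqSn]|n [eqn eqSn]].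
- rewrite -addn1 PoszD; split=> //.
  apply: (addIr (g n)); rewrite {2}eqn.
  by have := recg (n%:Z + 1); rewrite addrK eqSn rech addrK => <-.
- have -> : - n.+1%:Z = - n%:Z - 1 by lia.
  rewrite subrK; split=> //.
  by apply: (addrI (g (- n%:Z + 1))); rewrite -recg {1}eqn rech eqSn.
Qed.

Lemma chebU_solution (g : int -> E) : chebyshev_recurrent g ->
  forall n : int,
    g n = poly_op (chebU K (n - 1)) A (g 1) - poly_op (chebU K (n - 2)) A (g 0).
Proof.
move=> recg; apply: chebyshev_recurrent_eq => //.
(* The right-hand side satisfies the recurrence in [n] because $2xU_m=U_{m+1}+U_{m-1}$ for every
   integer $m$. *)
- move=> j; rewrite linearB /= scalerBr.
  have recU m x : 2 *: A (poly_op (chebU K m) A x) =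
      poly_op (chebU K (m + 1)) A x + poly_op (chebU K (m - 1)) A x.
    have := chebUD2 K (m - 1); rewrite subrK.
    have -> : m - 1 + 2 = m + 1 by lia.
    by move=> ->; rewrite poly_opD poly_opN subrK poly_opZ poly_opXM.
  by rewrite !recU opprD addrACA !(addrAC j _ 1) (addrAC j (- 2)).
(* Initial values: $U_{-1}=0$ and $U_{-2}=-1$ at 0, then $U_0=1$ and $U_{-1}=0$ at 1. *)
- by rewrite /= poly_op0 poly_opN poly_op1 sub0r opprK.
- by rewrite /= poly_op0 poly_op1 subr0.
Qed.

Lemma chebT_translate (g : int -> E) : chebyshev_recurrent g ->
  forall k j : int, 2 *: poly_op (chebT K k) A (g j) = g (j + k) + g (j - k).
Proof.
move=> recg k j.
suff natT (n : nat) :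
    2 *: poly_op (chebT_nat K n) A (g j) = g (j + n%:Z) + g (j - n%:Z).
  (* Both $T_k$ and the right-hand side are even in [k]. *)
  rewrite /chebT natT; case: k => n //.
  by rewrite abszE NegzE opprK addrC.
suff [] : 2 *: poly_op (chebT_nat K n) A (g j) = g (j + n%:Z) + g (j - n%:Z) /\
  2 *: poly_op (chebT_nat K n.+1) A (g j) = g (j + n.+1%:Z) + g (j - n.+1%:Z) by [].
elim: n => [|n [IHn IHSn]].
  by rewrite /= poly_op1 poly_opX recg !addr0 scaler_nat mulr2n.
split=> //.
have -> : chebT_nat K n.+2 = 2 *: ('X * chebT_nat K n.+1) - chebT_nat K n by [].
rewrite poly_opD poly_opN poly_opZ poly_opXM.
rewrite scalerBr IHn -(linearZZ A) IHSn linearD scalerDr !recg.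
have -> : j + n.+1%:Z + 1 = j + n.+2%:Z by lia.
have -> : j + n.+1%:Z - 1 = j + n%:Z by lia.
have -> : j - n.+1%:Z + 1 = j - n%:Z by lia.
have -> : j - n.+1%:Z - 1 = j - n.+2%:Z by lia.
(* The inner terms [g (j + n)] and [g (j - n)] cancel against the contribution of $-T_n$. *)
by rewrite [g (j - n%:Z) + _]addrC addrACA addrK.
Qed.

End TwoSidedRecurrence.

Section Mu1.
Variables (R : realType) (V : choiceType) (e : rel V) (q : nat).

(* Finiteness of the neighbourhoods is essential: [mu1] sums to 0 over an
   infinite support, so it is not additive in general. *)
Lemma mu1_linear : (forall v, finite_set [set w | e v w]%classic) ->
  linear (mu1 e q : (V -> R[i]) -> V -> R[i]).
Proof.
move=> fin a f g; apply/funext => v.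
rewrite /mu1 fctE /= fsbig_split // !fctE mulrDr.
by rewrite -mulr_fsumr mulrCA.
Qed.

End Mu1.

Theorem theorem4p2 (R : realType) (V : choiceType) (e : rel V) (q : nat)
    (f : int -> V -> R[i]) :
  (1 <= q)%N -> homogeneous_tree e q -> is_wave e q f ->
  forall n k : int,
    f (n * k) =
      poly_op (chebU _ (n - 1)) (poly_op (chebT _ k) (mu1 e q)) (f k)
      - poly_op (chebU _ (n - 2)) (poly_op (chebT _ k) (mu1 e q)) (f 0).
Proof.
move=> _ [_ deg] wave n k.
have fin v : finite_set [set w | e v w]%classic.
  by apply/finite_setP; exists q.+1.
pose lin := GRing.isLinear.Build _ _ _ _ _ (mu1_linear R V e q fin).
pose A : {linear (V -> R[i]) -> (V -> R[i])} := HB.pack (mu1 e q) lin.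
have recf : chebyshev_recurrent A f.
  by move=> j; rewrite [A _]wave scalerA divff ?scale1r // pnatr_eq0.
pose B : {linear (V -> R[i]) -> (V -> R[i])} := poly_op (chebT _ k) A.
have recB : chebyshev_recurrent B (fun m => f (m * k)).
  (* Translation by [k] from index [j * k] lands on the indices [(j + 1) * k] and [(j - 1) * k]. *)
  by move=> j; rewrite [LHS](chebT_translate _ _ recf) mulrDl mulrBl mul1r.
by have := chebU_solution _ _ recB n; rewrite mul1r mul0r.
Qed.
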